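(* There exist $d\in\mathbb{N}$, a convex compact set $X\subset\mathbb{R}^d$ equal to the closure of its interior, and a finite random iterated function system $(\vec p,\Psi)$ on $X$ in the sense of the context below (in particular, each $\Psi^{(i)}$ consists of contracting similarities satisfying the open set condition with respect to $\mathrm{Int}(X)$) such that for $\mathbb{P}_{\vec p}$-almost every $\omega\in\Omega$, $$\dim_H\big(J(\Psi(\omega))\big)<B(\Psi).$$
   Context: Let $d\in\mathbb{N}$ and let $X\subset\mathbb{R}^d$ be convex, compact, and equal to the closure of its interior $\mathrm{Int}(X)$. For each $i\in\mathbb{N}$ let $\Psi^{(i)}=\{\psi^{(i)}_j:X\to X\}_{j\in I^{(i)}}$, where $I^{(i)}$ is a countable index set with $\#I^{(i)}\ge 2$, each $\psi^{(i)}_j$ is an affine similarity with contraction ratio $c^{(i)}_j\in(0,1)$ (i.e. $|\psi^{(i)}_j(x)-\psi^{(i)}_j(y)|=c^{(i)}_j|x-y|$ for all $x,y\in X$), and $\psi^{(i)}_j(\mathrm{Int}(X))\cap\psi^{(i)}_{\tilde j}(\mathrm{Int}(X))=\emptyset$ whenever $j\neq\tilde j$ in $I^{(i)}$. Assume there is $\eta\in(0,1)$ with $c^{(i)}_j<\eta$ for all $i,j$. Let $\Psi=\{\Psi^{(i)}\}_{i\in\mathbb{N}}$ and let $\vec p=(p_1,p_2,\dots)$ be a probability vector. Let $\Omega=\mathbb{N}^{\mathbb{N}}$ with the $\sigma$-algebra generated by cylinders and $\mathbb{P}=\mathbb{P}_{\vec p}$ the Bernoulli (product) measure with $\mathbb{P}([\omega_1\dots\omega_n])=p_{\omega_1}\cdots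 p_{\omega_n}$. The pair $(\vec p,\Psi)$ is a random iterated function system (RIFS); it is finite if $\#I^{(i)}<\infty$ for every $i$ with $p_i>0$. For $\omega\in\Omega$ and $n\in\mathbb{N}$ let $\Sigma^n_\omega=\prod_{k=1}^n I^{(\omega_k)}$, for $\tau\in\Sigma^n_\omega$ let $\psi^{(\omega)}_\tau=\psi^{(\omega_1)}_{\tau_1}\circ\cdots\circ\psi^{(\omega_n)}_{\tau_n}$, and define the random limit set $J(\Psi(\omega))=\bigcap_{n\ge1}\bigcup_{\tau\in\Sigma^n_\omega}\psi^{(\omega)}_\tau(X)$. The Bowen parameter is $$B(\Psi)=\inf\Big\{t\ge0:\ \sum_{i\in\mathbb{N}}p_i\log\sum_{j\in I^{(i)}}\big(c^{(i)}_j\big)^t\le 0\Big\},$$ where the series is understood as an extended real number in $[-\infty,\infty]$. $\dim_H$ denotes Hausdorff dimension with respect to the Euclidean metric. *)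

(* Defs.v *)
(* Euclidean space R^d is 'rV[R]_d with the
   Euclidean norm defined below (mathcomp's default norm on 'rV is the sup
   norm, which induces the same topology but not the same metric). *)
From HB Require Import structures.
From mathcomp Require Import all_boot all_order all_algebra.
From mathcomp Require Import all_classical all_reals all_analysis.
From mathcomp Require Import Rstruct Rstruct_topology.
Set Implicit Arguments. Unset Strict Implicit. Unset Printing Implicit Defensive.
Import Order.TTheory GRing.Theory Num.Theory.
Import numFieldNormedType.Exports.
Local Open Scope classical_set_scope.
Local Open Scope ring_scope.

Section Defs.
Variable R : realType.
Variable d : nat.
Notation V := 'rV[R]_d.

Definition enorm (x : V) : R := Num.sqrt (\sum_(k < d) x ord0 k ^+ 2).
Definition edist (x y : V) : R := enorm (x - y).

Definition affine_map (f : V -> V) : Prop :=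
  exists (A : 'M[R]_d) (b : V), forall x, f x = x *m A + b.

Definition affine_similarity_on (X : set V) (f : V -> V) (c : R) : Prop :=
  affine_map f /\ forall x y, X x -> X y -> edist (f x) (f y) = c * edist x y.

(* Euclidean diameter (extended real; diam set0 = -oo) *)
Definition ediam (U : set V) : \bar R :=
  ereal_sup [set (edist x y)%:E | x in U & y in U].

Definition hausdorff_delta (s delta : R) (E : set V) : \bar R :=
  ereal_inf [set (\sum_(n <oo) (powR (fine (ediam (U n))) s)%:E)%E
            | U in [set U : nat -> set V |
                    E `<=` \bigcup_n U n /\ forall n, (ediam (U n) <= delta%:E)%E]].

Definition hausdorff_measure (s : R) (E : set V) : \bar R :=
  ereal_sup [set hausdorff_delta s delta E | delta in [set delta : R | 0 < delta]].

Definition hausdorff_dim (E : set V) : \bar R :=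
  ereal_inf [set s%:E | s in [set s : R | 0 < s /\ hausdorff_measure s E = 0%E]].

End Defs.

Section RIFS.
Variable R : realType.
Variable d : nat.
Notation V := 'rV[R]_d.

Definition is_RIFS (X : set V) (p : nat -> R) (I : nat -> set nat)
    (psi : nat -> nat -> V -> V) (c : nat -> nat -> R) : Prop :=
  [/\ (forall i, 0 <= p i) /\ (\sum_(i <oo) (p i)%:E = 1)%E,
      (forall i, exists j1 j2, I i j1 /\ I i j2 /\ j1 <> j2),
      (forall i j, I i j ->
          [/\ 0 < c i j < 1, psi i j @` X `<=` X &
              affine_similarity_on X (psi i j) (c i j)]),
      (forall i j j', I i j -> I i j' -> j <> j' ->
          psi i j @` (@interior V X) `&` psi i j' @` (@interior V X) = set0) &
      (exists eta : R, 0 < eta < 1 /\ forall i j, I i j -> c i j < eta)].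

Definition finite_RIFS (p : nat -> R) (I : nat -> set nat) : Prop :=
  forall i, 0 < p i -> finite_set (I i).

(* Omega = nat^nat (0-indexed).  psi_tau for the first n letters:
   psi^{(w_0)}_{tau_0} o ... o psi^{(w_{n-1})}_{tau_{n-1}} *)
Fixpoint psi_word (psi : nat -> nat -> V -> V) (w tau : nat -> nat) (n : nat)
  : V -> V :=
  match n with
  | 0 => id
  | n'.+1 => psi_word psi w tau n' \o psi (w n') (tau n')
  end.

Definition limit_set (X : set V) (I : nat -> set nat)
    (psi : nat -> nat -> V -> V) (w : nat -> nat) : set V :=
  \bigcap_n \bigcup_(tau in [set tau : nat -> nat |
                              forall k, (k < n.+1)%N -> I (w k) (tau k)])
              (psi_word psi w tau n.+1 @` X).

Definition eln (x : \bar R) : \bar R :=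
  match x with
  | EFin r => if r <= 0 then -oo%E else (ln r)%:E
  | +oo%E => +oo%E
  | -oo%E => -oo%E
  end.

(* value in [-oo,+oo] of a real-or-extended series: positive part minus
   negative part (mathcomp convention +oo - +oo = -oo) *)
Definition eseries (f : nat -> \bar R) : \bar R :=
  ((\sum_(i <oo) (f^\+ i)) - (\sum_(i <oo) (f^\- i)))%E.

Definition pressure (p : nat -> R) (I : nat -> set nat) (c : nat -> nat -> R)
    (t : R) : \bar R :=
  eseries (fun i => ((p i)%:E * eln (\esum_(j in I i) (powR (c i j) t)%:E))%E).

Definition bowen_parameter (p : nat -> R) (I : nat -> set nat)
    (c : nat -> nat -> R) : \bar R :=
  ereal_inf [set t%:E | t in [set t : R | 0 <= t /\ (pressure p I c t <= 0)%E]].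

End RIFS.

Section Bernoulli.
Variable R : realType.
Definition cylinder (s : seq nat) : set (nat -> nat) :=
  [set w | forall k, (k < size s)%N -> w k = nth 0%N s k].
Definition cylinder_prob (p : nat -> R) (s : seq nat) : R :=
  \prod_(a <- s) p a.
(* E is P_p-null: outer measure (from the cylinder premeasure) is 0 *)
Definition bernoulli_null (p : nat -> R) (E : set (nat -> nat)) : Prop :=
  forall eps : R, 0 < eps -> exists S : nat -> seq nat,
    E `<=` \bigcup_n cylinder (S n) /\
    (\sum_(n <oo) (cylinder_prob p (S n))%:E <= eps%:E)%E.
Definition bernoulli_ae (p : nat -> R) (P : (nat -> nat) -> Prop) : Prop :=
  bernoulli_null p [set w | ~ P w].
End Bernoulli.

(* Main.v *)
(* A one-dimensional system on [0,1].  The i-th letter has 2^(a_i) maps, all of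
   ratio 4^(-a_i), placed side by side next to 0, where a_i = 3^i i!.  Every term
   of the pressure at t < 1/2 is nonnegative, and positive for i > 0, so the Bowen
   parameter is at least 1/2.  The letter distribution has tail P(omega_k > m)
   = 1/(m+1), so heavy that almost surely omega_n > C + n for some n, whatever C;
   hence infinitely often a_(omega_n) >= 3 A, where A is the sum of the
   a_(omega_k) over k < n.  At such a time the level n+1 cylinders cluster in 2^A
   intervals of length 4^(-A) 2^(-a_(omega_n)) <= 2^(-5A), and covering by these
   gives dimension at most 2/5. *)
Require Import Defs.
From HB Require Import structures.
From mathcomp Require Import all_boot all_order all_algebra.
From mathcomp Require Import all_classical all_reals all_analysis.
From mathcomp Require Import Rstruct Rstruct_topology.
From mathcomp Require Import ring lra zify.
Import Order.TTheory GRing.Theory Num.Theory.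
Import numFieldNormedType.Exports.
Local Open Scope classical_set_scope.
Local Open Scope ring_scope.

(** * Finite families as sequences, Bernoulli null sets, and the letter distribution *)

(** Null sets and Hausdorff measure are defined by infinite covers. This lets a finite list serve as
    one, since the padding entries [x0] cost nothing. *)
Lemma nneseries_nth (R : realType) (T : Type) (F : T -> R) (x0 : T) (L : seq T) :
  F x0 = 0 -> (forall x, 0 <= F x) ->
  (\sum_(n <oo) (F (nth x0 L n))%:E = (\sum_(x <- L) F x)%:E)%E.
Proof.
move=> F0 Fge0.
rewrite (nneseries_split 0 (size L)); last by move=> k _; rewrite lee_fin.
rewrite add0n (big_nth x0) sumEFin eseries0 ?adde0// => k kL _.
by rewrite nth_default ?F0.
Qed.

Lemma cylinder_prob_ge0 (R : realType) (p : nat -> R) (s : seq nat) :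
  (forall i, 0 <= p i) -> 0 <= cylinder_prob p s.
Proof. by move=> p0; apply: prodr_ge0. Qed.

Lemma bernoulli_null_bigcup (R : realType) (p : nat -> R)
    (E : nat -> set (nat -> nat)) :
  (forall i, 0 <= p i) -> (forall C, bernoulli_null p (E C)) ->
  bernoulli_null p (\bigcup_C E C).
Proof.
move=> p0 nullE eps eps0.
pose Q C (S : nat -> seq nat) := E C `<=` \bigcup_n cylinder (S n) /\
  (\sum_(n <oo) (cylinder_prob p (S n))%:E <= (eps / (2 ^ C.+1)%:R)%:E)%E.
have [S QS] : {S : nat -> nat -> seq nat & forall C, Q C (S C)}.
  apply: (@choice _ _ Q) => C; apply: nullE.
  by rewrite divr_gt0// ltr0n expn_gt0.
have cge0 s : (0 <= (cylinder_prob p s)%:E :> \bar R)%E.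
  by rewrite lee_fin cylinder_prob_ge0.
have /card_esym/ppcard_eqP[f] := card_nat2.
exists (fun n => S (f n).1 (f n).2); split.
  move=> w [C _ /(QS C).1[n _ wn]]; exists (f^-1%FUN (C, n)) => //.
  by rewrite invK ?inE.
(* The cost of the merged cover, enumerated by pairs, is regrouped as a double sum whose row [C] is
   at most eps / 2^(C+1). *)
rewrite nneseries_esumT; last by move=> *; exact: cge0.
rewrite -(reindex_esum setT setT f
  (fun k => (cylinder_prob p (S k.1 k.2))%:E)); last exact: bij.
rewrite (_ : setT = setT `*`` (fun=> setT)); last first.
  by apply/seteqP; split.
rewrite -(@esum_esum _ _ _ setT (fun=> setT)
  (fun C n => (cylinder_prob p (S C n))%:E)); last by move=> *; exact: cge0.
rewrite -nneseries_esumT; last by move=> *; apply: esum_ge0 => *; exact: cge0.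
apply: (@le_trans _ _ (\sum_(C <oo) (0 + (eps / (2 ^ C.+1)%:R)%:E)%E)%E).
  apply: lee_nneseries => [*|C _]; first by apply: esum_ge0 => *; exact: cge0.
  rewrite add0e -nneseries_esumT; first exact: (QS C).2.
  by move=> n; exact: cge0.
apply: (le_trans (epsilon_trick xpredT (fun=> lexx _) (ltW eps0))).
by rewrite eseries0 ?add0e.
Qed.

(* The letter 0 carries no mass, so it can pad finite families of cylinders. *)
Definition weight (R : realType) (i : nat) : R :=
  if i is k.+1 then (k.+1%:R)^-1 - (k.+2%:R)^-1 else 0.

Lemma weight_ge0 (R : realType) i : 0 <= weight R i.
Proof.
by case: i => //= i; rewrite subr_ge0 lef_pV2 ?posrE ?ltr0n// ler_nat.
Qed.

Lemma sum_weight (R : realType) n :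
  \sum_(0 <= i < n.+1) weight R i = 1 - (n.+1%:R)^-1.
Proof.
elim: n => [|n IH]; first by rewrite big_nat1 invr1 subrr.
by rewrite big_nat_recr//= IH addrA subrK.
Qed.

Lemma weight_total (R : realType) : (\sum_(i <oo) (weight R i)%:E = 1)%E.
Proof.
apply/cvg_lim => //; rewrite -(cvg_shiftS (fun n => \sum_(0 <= i < n) _)%E) /=.
under eq_fun do rewrite sumEFin sum_weight.
apply: cvg_EFin; first exact: nearW.
rewrite -[X in _ --> X]subr0; apply: cvgB; first exact: cvg_cst.
exact: cvg_harmonic.
Qed.

(** * Sequences with at most linear growth form a null set *)

Fixpoint slow_words (C n : nat) : seq (seq nat) :=
  if n is n'.+1 then [seq rcons s i | s <- slow_words C n', i <- iota 0 (C + n').+1]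
  else [:: [::]].

Lemma slow_wordsS (C n : nat) : slow_words C n.+1 =
  [seq rcons s i | s <- slow_words C n, i <- iota 0 (C + n).+1].
Proof. by []. Qed.

Lemma slow_words_cover (C n : nat) (w : nat -> nat) :
  (forall k, (w k <= C + k)%N) -> mkseq w n \in slow_words C n.
Proof.
move=> wC; elim: n => [//|n IH].
rewrite slow_wordsS mkseqS; apply/allpairsPdep; exists (mkseq w n), (w n); split=> //.
by rewrite mem_iota/= add0n ltnS.
Qed.

(** Position k admits the letters up to C+1+k, of total mass (C+1+k)/(C+2+k), and the product
    telescopes. Taking [C.+1] keeps the denominator nonzero at n = 0. *)
Lemma slow_words_prob (R : realType) (C n : nat) :
  \sum_(s <- slow_words C.+1 n) cylinder_prob (weight R) s =
  C.+1%:R / (C.+1 + n)%:R.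
Proof.
elim: n => [|n IH].
  by rewrite big_seq1 /cylinder_prob big_nil addn0 divff// pnatr_eq0.
rewrite slow_wordsS big_allpairs_dep.
have sumE : \sum_(i <- iota 0 (C.+1 + n).+1) weight R i =
    (C.+1 + n)%:R / (C.+1 + n.+1)%:R.
  have := sum_weight R (C.+1 + n); rewrite /index_iota subn0 => ->.
  rewrite addnS -[X in X - _](divff (x := (C.+1 + n).+1%:R)) ?pnatr_eq0//.
  by rewrite -[X in _ - X]div1r -mulrBl -natr1 addrK.
have rconsE s : \sum_(i <- iota 0 (C.+1 + n).+1)
    cylinder_prob (weight R) (rcons s i) =
    cylinder_prob (weight R) s * ((C.+1 + n)%:R / (C.+1 + n.+1)%:R).
  rewrite -sumE big_distrr; apply: eq_bigr => i _.
  by rewrite /cylinder_prob -cats1 big_cat big_seq1.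
under [LHS]eq_bigr do rewrite rconsE.
by rewrite -big_distrl/= IH mulrA divfK.
Qed.

Lemma slow_null (R : realType) (C : nat) :
  bernoulli_null (weight R) [set w | forall k, (w k <= C + k)%N].
Proof.
move=> eps eps0.
(* With n > (C+1)/eps the covering mass (C+1)/(C+1+n) is at most eps. *)
pose n := (Num.truncn (C.+1%:R / eps)).+1.
have c0 : cylinder_prob (weight R) [:: 0%N] = 0.
  by rewrite /cylinder_prob big_seq1.
exists (nth [:: 0%N] (slow_words C.+1 n)); split => [w/= wC|].
  have wC1 k : (w k <= C.+1 + k)%N by rewrite addSn ltnW// ltnS.
  have := slow_words_cover C.+1 n w wC1.
  set s := mkseq w n => /(nthP [:: 0%N])[m _ sm].
  exists m => //; rewrite sm /s => k; rewrite size_mkseq => kn.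
  by rewrite nth_mkseq.
rewrite nneseries_nth//; last first.
  by move=> s; apply: cylinder_prob_ge0; exact: weight_ge0.
rewrite lee_fin slow_words_prob ler_pdivrMr ?ltr0n// mulrC -ler_pdivrMr//.
apply: ltW; apply: (lt_le_trans (truncnS_gt _)).
by rewrite ler_nat leq_addl.
Qed.

(** * Growth of the rates and record times *)

Definition rate (i : nat) : nat := (3 ^ i * i`!)%N.

Lemma rateS i : rate i.+1 = (3 * i.+1 * rate i)%N.
Proof. by rewrite /rate expnS factS; lia. Qed.

Lemma rate_gt0 i : (0 < rate i)%N.
Proof. by rewrite muln_gt0 expn_gt0 fact_gt0. Qed.

Lemma rate_le i j : (i <= j)%N -> (rate i <= rate j)%N.
Proof.
move=> /subnK <-; elim: (j - i)%N => [//|k IH].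
by rewrite addSn rateS (leq_trans IH)// leq_pmull.
Qed.

Definition total_rate (w : nat -> nat) (n : nat) : nat :=
  (\sum_(0 <= k < n) rate (w k))%N.

Lemma total_rate_ge w n : (n <= total_rate w n)%N.
Proof.
rewrite -[leqLHS]subn0 -[leqLHS]muln1 -sum_nat_const_nat.
by apply: leq_sum => k _; exact: rate_gt0.
Qed.

(* The first time [n] at which [w n > C + n] for a large [C] is a strict record
   of size more than [n], so [rate (w n) >= 3 n rate (w n - 1)] dominates the
   [n] earlier rates. *)
Lemma rate_record (w : nat -> nat) (N : nat) :
  (forall C, exists n, (C + n < w n)%N) ->
  exists2 n, (N <= n)%N & (3 * total_rate w n <= rate (w n))%N.
Proof.
(* [C] bounds the first N letters, so a time with C + n < w n cannot come before N. *)
move=> fast; pose C := (\max_(k < N) w k)%N.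
have wC k : (k < N)%N -> (w k <= C)%N.
  by move=> kN; apply: (@leq_bigmax _ (fun k : 'I_N => w k) (Ordinal kN)).
case: (ex_minnP (fast C)) => n wn nmin.
have record k : (k < n)%N -> (w k < w n)%N.
  move=> kn; case: (ltnP (C + k) (w k)) => [/nmin|]; lia.
exists n; first by rewrite leqNgt; apply/negP => /wC; lia.
case: (w n) wn record => [//|m] nm record.
have : (total_rate w n <= n * rate m)%N.
  rewrite -[X in (_ <= X * _)%N]subn0 -sum_nat_const_nat /total_rate big_nat [leqRHS]big_nat.
  by apply: leq_sum => k /andP[_ /record km]; apply: rate_le.
rewrite rateS; have : (n * rate m <= m.+1 * rate m)%N by rewrite leq_mul2r; lia.
lia.
Qed.

(** * Hausdorff dimension bounded through finite covers *)

Lemma ediam0 (R : realType) (d : nat) : ediam (set0 : set 'rV[R]_d) = -oo%E.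
Proof.
rewrite /ediam (_ : [set _ | _ in _ & _ in _] = set0) ?ereal_sup0//.
by apply/seteqP; split => // t [x []].
Qed.

(** A single eps bounds both the mesh and the s-sum: applied to the minimum of delta and eps, the
    hypothesis makes every [hausdorff_delta] vanish. *)
Lemma hausdorff_dim_le (R : realType) (d : nat) (E : set 'rV[R]_d) (s : R) :
  0 < s ->
  (forall eps : R, 0 < eps -> exists2 L : seq (set 'rV[R]_d),
    E `<=` \bigcup_n nth set0 L n /\ (forall U, U \in L -> (ediam U <= eps%:E)%E) &
    \sum_(U <- L) fine (ediam U) `^ s <= eps) ->
  (hausdorff_dim E <= s%:E)%E.
Proof.
move=> s0 coverE; apply: ge_ereal_inf; exists s%:E => //; exists s => //; split=> //.
have meas_ge0 delta : (0 <= hausdorff_delta s delta E)%E.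
  apply: le_ereal_inf_tmp => _ [U _ <-]; apply: nneseries_ge0 => n _ _.
  by rewrite lee_fin powR_ge0.
apply/eqP; rewrite eq_le; apply/andP; split; last first.
  by apply: le_ereal_sup_tmp; exists (hausdorff_delta s 1 E) => //; exists 1 => /=.
apply: ge_ereal_sup => _ [delta delta0 <-].
apply/lee_addgt0Pr => eps eps0; rewrite add0e.
have e0 : 0 < Num.min delta eps by rewrite lt_min delta0.
have [L [EL diamL] sumL] := coverE _ e0.
apply: ge_ereal_inf; exists ((\sum_(U <- L) fine (ediam U) `^ s)%:E).
  exists (nth set0 L).
    split=> // n; case: (ltnP n (size L)) => nL.
      by apply: (le_trans (diamL _ (mem_nth _ nL))); rewrite lee_fin ge_min lexx.
    by rewrite nth_default// ediam0 leNye.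
  (* Padding by the empty set is free: its diameter is -oo, which [fine] sends to 0, and 0 to the
     power s is 0 because s is nonzero. *)
  rewrite (@nneseries_nth _ _ (fun U => fine (ediam U) `^ s))// => [|U].
    by rewrite ediam0 /= powR0// gt_eqF.
  exact: powR_ge0.
by rewrite lee_fin (le_trans sumL)// ge_min lexx orbT.
Qed.

Lemma edist1 (R : realType) (x y : 'rV[R]_1) :
  Defs.edist x y = `|x ord0 ord0 - y ord0 ord0|.
Proof. by rewrite /Defs.edist /enorm big_ord1 sqrtr_sqr !mxE. Qed.

Definition slab (R : realType) (o r : R) : set 'rV[R]_1 :=
  [set x | o <= x ord0 ord0 <= o + r].

Lemma ediam_slab (R : realType) (o r : R) : (ediam (slab R o r) <= r%:E)%E.
Proof.
apply: ge_ereal_sup => _ [x /andP[x1 x2] [y /andP[y1 y2] <-]].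
rewrite lee_fin edist1 ler_norml; apply/andP; split; lra.
Qed.

Lemma fine_ediam_slab (R : realType) (o r : R) :
  0 <= r -> 0 <= fine (ediam (slab R o r)) <= r.
Proof.
move=> r0; have le_r := ediam_slab R o r.
have ge_0 : (0 <= ediam (slab R o r))%E.
  (* The slab is nonempty, so its diameter is not -oo and [fine] returns the true value. *)
  have o_slab : slab R o r (const_mx o) by rewrite /slab/= mxE lexx lerDl.
  apply: le_ereal_sup_tmp; exists 0%E => //.
  exists (const_mx o) => //; exists (const_mx o) => //.
  by rewrite edist1 subrr normr0.
rewrite fine_ge0//= -lee_fin fineK//.
by rewrite fin_real// (lt_le_trans _ ge_0)// (le_lt_trans le_r)// ltry.
Qed.

(** * The system and the covers of its limit sets *)

Definition ratio (R : realType) (i : nat) : R := (4^-1) ^+ rate i.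

Definition contraction (R : realType) (i j : nat) (x : 'rV[R]_1) : 'rV[R]_1 :=
  ratio R i *: (x + const_mx j%:R).

Definition branches (i : nat) : set nat := `I_(2 ^ rate i).

(** Left endpoints of the level-n cylinders, each of length 4^(-[total_rate w n]). Only their number
    matters for the cover. *)
Fixpoint offsets (R : realType) (w : nat -> nat) (n : nat) : seq R :=
  if n is n'.+1 then
    [seq o + (4^-1) ^+ total_rate w n'.+1 * j%:R
      | o <- offsets R w n', j <- iota 0 (2 ^ rate (w n'))]
  else [:: 0].

Lemma offsetsS (R : realType) w n : offsets R w n.+1 =
  [seq o + (4^-1) ^+ total_rate w n.+1 * j%:R
    | o <- offsets R w n, j <- iota 0 (2 ^ rate (w n))].
Proof. by []. Qed.

Lemma total_rateS w n : total_rate w n.+1 = (total_rate w n + rate (w n))%N.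
Proof. by rewrite /total_rate big_nat_recr. Qed.

Lemma size_offsets (R : realType) w n :
  size (offsets R w n) = (2 ^ total_rate w n)%N.
Proof.
elim: n => [|n IH]; first by rewrite /total_rate big_geq.
rewrite offsetsS size_allpairs IH size_iota total_rateS.
by rewrite expnD.
Qed.

Lemma psi_word_offset (R : realType) (w tau : nat -> nat) (n : nat) :
  (forall k, (k < n)%N -> branches (w k) (tau k)) ->
  exists2 o, o \in offsets R w n & forall x,
    psi_word (contraction R) w tau n x ord0 ord0 =
    o + (4^-1) ^+ total_rate w n * x ord0 ord0.
Proof.
elim: n => [|n IH] taun.
  exists 0; first by rewrite inE.
  by move=> x; rewrite /total_rate big_geq//= expr0 mul1r add0r.
have [k kn|o oL psiE] := IH; first by apply: taun; exact: leqW.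
exists (o + (4^-1) ^+ total_rate w n.+1 * (tau n)%:R).
  rewrite offsetsS; apply/allpairsPdep; exists o, (tau n); split=> //; rewrite mem_iota add0n.
  exact: taun.
move=> x; rewrite [psi_word _ _ _ _]/= /comp psiE !mxE total_rateS exprD /ratio.
ring.
Qed.

(** Inside each level-n cylinder, the 2^a images for the letter [w n] of rate a have relative length
    4^(-a) and sit side by side at the left end, so they fill only a fraction 2^(-a) of it. *)
Lemma limit_set_slabs (R : realType) (w : nat -> nat) (n : nat) :
  limit_set (slab R 0 1) branches (contraction R) w `<=`
  \bigcup_m nth set0 [seq slab R o
    ((4^-1) ^+ total_rate w n * (2^-1) ^+ rate (w n)) | o <- offsets R w n] m.
Proof.
(* Index n of the intersection concerns words of length n+1; the first n letters give the offset and
   the last one gives the cluster. *)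
move=> _ /(_ n I)[tau/= taun [x /andP[x0 x1] <-]].
have [k kn|o /(nthP 0)[m mL om] psiE] := @psi_word_offset R w tau n.
  by apply: taun; exact: leqW.
exists m => //; rewrite (nth_map 0)// om /slab/= psiE.
have c0 : 0 <= (4^-1) ^+ total_rate w n :> R by rewrite exprn_ge0// invr_ge0.
rewrite lerDl lerD2l; apply/andP; split.
  by rewrite mulr_ge0// !mxE mulr_ge0 ?exprn_ge0 ?invr_ge0// addr_ge0.
rewrite ler_wpM2l// !mxE /ratio.
have -> : 4^-1 = 2^-1 * 2^-1 :> R by rewrite -invfM -natrM.
rewrite exprMn -mulrA ler_piMr ?exprn_ge0 ?invr_ge0//.
rewrite exprVn mulrC ler_pdivrMr ?exprn_gt0// mul1r.
have : (tau n).+1%:R <= (2 ^ rate (w n))%:R :> R.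
  by rewrite ler_nat; exact: taun.
rewrite natrX -natr1 => h; lra.
Qed.

(** The 2^A slabs have length at most 2^(-5A), so any exponent above 1/5 would do. The value 2/5 is
    below 1/2 and gives the s-sum 2^A 2^(-2A) = 2^(-A), which is at most eps because A >= n >= N. *)
Lemma dim_limit_set_le (R : realType) (w : nat -> nat) :
  (forall C, exists n, (C + n < w n)%N) ->
  (hausdorff_dim (limit_set (slab R 0 1) branches (contraction R) w)
    <= (2 / 5)%:E)%E.
Proof.
move=> fast; apply: hausdorff_dim_le => [|eps eps0]; first lra.
have half0 : 0 <= 2^-1 :> R by rewrite invr_ge0.
have [N Neps] : exists N, (2^-1) ^+ N <= eps.
  exists (Num.truncn eps^-1).
  rewrite exprVn -[leRHS]invrK lef_pV2 ?posrE ?exprn_gt0 ?invr_gt0//.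
  apply: ltW; apply: (lt_le_trans (truncnS_gt _)).
  by rewrite -natrX ler_nat ltn_expl.
have [n Nn records] := @rate_record w N fast.
set A := total_rate w n in records.
have NA : (N <= A)%N := leq_trans Nn (total_rate_ge w n).
have half_le k : (N <= k)%N -> (2^-1) ^+ k <= eps.
  move=> Nk; apply: le_trans Neps; rewrite ler_wiXn2l//; lra.
pose r : R := (4^-1) ^+ A * (2^-1) ^+ rate (w n).
have rE : r = (2^-1) ^+ (2 * A + rate (w n)) :> R.
  have quarter : 4^-1 = (2^-1) ^+ 2 :> R by field.
  by rewrite /r quarter exprD exprM.
have r0 : 0 <= r :> R by rewrite rE exprn_ge0.
exists [seq slab R o r | o <- offsets R w n].
  split; first exact: limit_set_slabs.
  move=> _ /mapP[ o _ ->]; apply: (le_trans (ediam_slab _ _ _)).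
  rewrite lee_fin rE half_le//; lia.
have powr_le o : fine (ediam (slab R o r)) `^ (2 / 5) <= (2^-1) ^+ (2 * A).
  have /andP[f0 fr] := fine_ediam_slab R o r r0.
  have -> : (2^-1) ^+ (2 * A) = ((2^-1) ^+ (5 * A)) `^ (2 / 5) :> R.
    rewrite -!powR_mulrn// -powRrM; congr (_ `^ _); rewrite !natrM; by field.
  apply: (@ge0_ler_powR R (2 / 5)); rewrite ?nnegrE// ?exprn_ge0//.
  apply: (le_trans fr); rewrite rE ler_wiXn2l//; [lra|lia].
rewrite big_map; apply: (le_trans (ler_sum _ (fun o _ => powr_le o))).
rewrite big_const_seq count_predT size_offsets iter_addr_0 -/A -[leLHS]mulr_natr natrX.
rewrite mul2n -addnn exprD -mulrA -exprMn mulVf ?pnatr_eq0// expr1n mulr1.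
exact: half_le.
Qed.

(** * Convexity, compactness and interior of intervals *)

Lemma slab_convex (R : realType) (o r : R) : convex_set (slab R o r).
Proof.
move=> x y t; rewrite !inE => /andP[x0 x1] /andP[y0 y1].
have t0 : 0 <= t%:num by exact: ge0.
have t1 : 0 <= 1 - t%:num by rewrite subr_ge0; exact: le1.
have convE : (conv t x y) ord0 ord0 =
    t%:num * x ord0 ord0 + (1 - t%:num) * y ord0 ord0.
  by rewrite /conv/= !mxE.
rewrite /slab/= convE; apply/andP; split; nra.
Qed.

Lemma slab_compact (R : realType) (o r : R) : compact (slab R o r).
Proof.
have -> : slab R o r =
    [set v : 'rV[R]_1 | forall i, `[o, o + r]%classic (v ord0 i)].
  apply/seteqP; split => x.
    by move=> xX i; rewrite (ord1 i) /= in_itv.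
  by move/(_ ord0); rewrite /= in_itv.
exact: (@rV_compact R 1 (fun=> `[o, o + r]%classic) (fun=> @segment_compact R o (o + r))).
Qed.

Lemma ball_const_mx (R : realType) (x : 'rV[R]_1) (e z : R) :
  `|x ord0 ord0 - z| < e -> ball x e (const_mx z : 'rV[R]_1).
Proof.
move=> xz; split; first exact: le_lt_trans (normr_ge0 _) xz.
by move=> i j; rewrite !ord1 mxE.
Qed.

Lemma interior_slab (R : realType) (o r : R) :
  interior (slab R o r) = [set x | o < x ord0 ord0 < o + r].
Proof.
apply/seteqP; split => x.
  move=> /nbhs_ballP[e /= e0 xe].
  have near z : `|x ord0 ord0 - z| < e -> o <= z <= o + r.
    by move=> /ball_const_mx/xe; rewrite /slab/= mxE.
  (* The ball also contains the points at signed distance e/2 on both sides of x, which makes the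
     inequalities strict. *)
  have /near : `|x ord0 ord0 - (x ord0 ord0 - e / 2)| < e.
    by rewrite opprB addrC subrK ger0_norm; lra.
  have /near : `|x ord0 ord0 - (x ord0 ord0 + e / 2)| < e.
    by rewrite opprD addrA subrr sub0r normrN ger0_norm; lra.
  rewrite /=; lra.
move=> xO; have xitv : x ord0 ord0 \in `]o, o + r[ by rewrite in_itv.
have xN : nbhs x [set y : 'rV[R]_1 | y ord0 ord0 \in `]o, o + r[].
  exact: (@coord_continuous R 1 1 ord0 ord0 x _ (near_in_itvoo xitv)).
apply: (filterS _ xN) => y /=; rewrite in_itv/= => /andP[y0 y1].
by rewrite /slab/= !ltW.
Qed.

Lemma closure_interior_slab (R : realType) (o r : R) : 0 < r ->
  closure (interior (slab R o r)) = slab R o r.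
Proof.
move=> r0; apply/seteqP; split.
  have /closure_id Xc : closed (slab R o r).
    exact: (compact_closed (@norm_hausdorff R 'rV[R]_1) (slab_compact R o r)).
  (* The interior lies in the slab, which is closed because it is compact. *)
  rewrite [X in _ `<=` X]Xc; apply: closureS; exact: interior_subset.
move=> x /andP[x0 x1] B /nbhs_ballP[e /= e0 xB].
pose s := Num.min (2^-1) (e / r).
have s0 : 0 < s by rewrite lt_min divr_gt0// invr_gt0 ltr0n.
have s1 : s <= 2^-1 by rewrite ge_min lexx.
have sr : s * r <= e by rewrite -ler_pdivlMr// ge_min lexx orbT.
set u := x ord0 ord0 in x0 x1.
(* The point is pulled towards the midpoint by a fraction s: this makes it interior and moves it by
   at most s r / 2 <= e / 2. *)
exists (const_mx (u + s * (o + r / 2 - u))); split.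
  rewrite interior_slab/= mxE; apply/andP; split; nra.
apply/xB/ball_const_mx; rewrite -/u opprD addrA subrr sub0r normrN.
rewrite normrM (gtr0_norm s0).
have : `|o + r / 2 - u| <= r / 2 by rewrite ler_norml; apply/andP; split; lra.
move: `|_| => v; nra.
Qed.

(** * Positivity of the pressure below 1/2 *)

Lemma two_le_branches (i : nat) : (2 <= 2 ^ rate i)%N.
Proof. by rewrite -[leqLHS]expn1 leq_exp2l ?rate_gt0. Qed.

(** With h = 2^(-a) < 1 the ratio is h^2, and h^(2t) > h as soon as 2t < 1. *)
Lemma ratio_powR_gt (R : realType) (i : nat) (t : R) : t < 2^-1 ->
  (2^-1) ^+ rate i < ratio R i `^ t.
Proof.
move=> t1; pose h : R := (2^-1) ^+ rate i.
have h0 : 0 < h by rewrite exprn_gt0// invr_gt0.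
have h1 : h < 1 by rewrite exprn_ilt1 -?lt0n ?rate_gt0//; lra.
have -> : ratio R i = h `^ 2.
  by rewrite powR_mulrn ?ltW// -exprM mulnC exprM /ratio; congr (_ ^+ _); field.
rewrite -/h -powRrM -[ltLHS]powRr1 ?ltW// /powR !gt_eqF//.
rewrite ltr_expR ltr_nM2r ?ln_lt0 ?h0//; lra.
Qed.

Lemma pressure_gt0 (R : realType) (t : R) : t < 2^-1 ->
  (0 < pressure (weight R) branches (fun i _ => ratio R i) t)%E.
Proof.
move=> t1.
have sum_gt1 i : (1%:E < \esum_(j in branches i) (ratio R i `^ t)%:E)%E.
  rewrite esum_fset; [|exact: finite_II|]; last first.
    by move=> j _; rewrite lee_fin powR_ge0.
  rewrite /branches -fsbig_ord sumEFin lte_fin sumr_const card_ord.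
  have := ratio_powR_gt R i t t1; rewrite exprVn => lt_t.
  rewrite -mulr_natr natrX -ltr_pdivrMr ?exprn_gt0// div1r.
  exact: lt_t.
pose f i := ((weight R i)%:E *
  eln (\esum_(j in branches i) (ratio R i `^ t)%:E))%E.
have eln_gt0 i : (0 < eln (\esum_(j in branches i) (ratio R i `^ t)%:E))%E.
  move: (sum_gt1 i); case: (\esum_(j in _) _)%E => [s| |]//=.
  by rewrite lte_fin => s1; rewrite leNgt (lt_trans ltr01 s1)/= lte_fin ln_gt0.
have f0 i : (0 <= f i)%E.
  by apply: mule_ge0; [rewrite lee_fin weight_ge0|exact: ltW].
change (0 < Defs.eseries f)%E; rewrite /Defs.eseries.
rewrite (_ : \sum_(i <oo) f^\- i = 0)%E ?sube0; last first.
  apply: eseries0 => i _ _; rewrite funenegE.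
  by apply/max_idPr; rewrite oppe_le0.
(* The terms of letters 0 and 1 suffice: letter 1 has mass 1/2, so its term is positive. *)
apply: lt_le_trans (nneseries_lim_ge 2 _) => [|i _ _]; last exact: funepos_ge0.
rewrite big_nat_recr//= big_nat1 !funeposE.
apply: (@lt_le_trans _ _ (f 1%N)).
  apply: mule_gt0 => //; rewrite lte_fin /=; lra.
apply: (@le_trans _ _ (maxe (f 1%N) 0)); first by rewrite le_max lexx.
by rewrite leeDr// le_max lexx orbT.
Qed.

Lemma bowen_ge (R : realType) :
  ((2^-1)%:E <= bowen_parameter (weight R) branches (fun i _ => ratio R i))%E.
Proof.
apply: le_ereal_inf_tmp => _ [t [t0 pt] <-]; rewrite lee_fin leNgt.
by apply/negP => /pressure_gt0; rewrite ltNge pt.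
Qed.

(** * Verification of the axioms of a random iterated function system *)

Lemma ratio_gt0 (R : realType) (i : nat) : 0 < ratio R i.
Proof. by rewrite exprn_gt0// invr_gt0. Qed.

Lemma ratio_le (R : realType) (i : nat) : ratio R i <= 4^-1.
Proof.
rewrite /ratio -[leRHS]expr1 ler_wiXn2l ?rate_gt0//; lra.
Qed.

(** This keeps the images inside [0,1]: with N = 2^a the ratio is N^(-2), and N adjacent intervals
    of that length reach only to 1/N. *)
Lemma ratio_branch_le (R : realType) (i j : nat) :
  branches i j -> ratio R i * j.+1%:R <= 1.
Proof.
move=> ij; have : j.+1%:R <= (2 ^ rate i)%:R :> R by rewrite ler_nat; exact: ij.
have -> : ratio R i = (2 ^ rate i)%:R^-1 * (2 ^ rate i)%:R^-1.
  by rewrite -invfM -natrM -expnMn /ratio exprVn natrX.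
set N := (_ ^ _)%N => jN.
have N0 : 0 < N%:R :> R by rewrite ltr0n expn_gt0.
rewrite -invfM mulrC ler_pdivrMr ?mulr_gt0// mul1r (le_trans jN)//.
by rewrite ler_peMr ?(ltW N0)// ler1n expn_gt0.
Qed.

Lemma contractionE (R : realType) i j (x : 'rV[R]_1) :
  contraction R i j x ord0 ord0 = ratio R i * (x ord0 ord0 + j%:R).
Proof. by rewrite !mxE. Qed.

Lemma contraction_RIFS (R : realType) :
  is_RIFS (slab R 0 1) (weight R) branches (contraction R) (fun i _ => ratio R i).
Proof.
split.
- by split; [move=> i; exact: weight_ge0|exact: weight_total].
- move=> i; exists 0%N, 1%N; split; last by split=> //; exact: two_le_branches.
  exact: ltnW (two_le_branches i).
- move=> i j ij; have c0 := ratio_gt0 R i; have c1 := ratio_le R i.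
  split.
  + by rewrite c0 (le_lt_trans c1)// invf_lt1// ltr1n.
  + move=> _ [x /andP[x0 x1] <-]; rewrite /slab/= contractionE.
    have := ratio_branch_le R i j ij; rewrite -natr1 => cj.
    have j0 : 0 <= j%:R :> R by [].
    apply/andP; split; nra.
  + split.
      exists (ratio R i)%:M, (ratio R i *: const_mx j%:R) => x.
      by rewrite mul_mx_scalar -scalerDr.
    move=> x y _ _; rewrite !edist1 !contractionE -mulrBr normrM (gtr0_norm c0).
    by rewrite opprD addrACA subrr addr0.
- move=> i j j' _ _ jj'; rewrite interior_slab add0r.
  apply/seteqP; split=> // _ [[x /andP[x0 x1] <-] [y /andP[y0 y1]]].
  (* After cancelling the common ratio, a shared point would lie in two integer translates of (0,1),
     which are disjoint. *)
  move=> /(congr1 (fun z : 'rV_1 => z ord0 ord0)).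
  rewrite !contractionE => /(mulfI (lt0r_neq0 (ratio_gt0 R i))) xy.
  case: (ltngtP j j') => // lt; have := lt; rewrite -(ler_nat R) -natr1; lra.
- exists (2^-1); split; first lra.
  move=> i j _; apply: (le_lt_trans (ratio_le R i)); lra.
Qed.

(** * The strict dimension drop for almost every sequence *)

Theorem theorem1p1 :
  exists (d : nat) (X : set 'rV[Rdefinitions.R]_d)
         (p : nat -> Rdefinitions.R) (I : nat -> set nat)
         (psi : nat -> nat -> 'rV[Rdefinitions.R]_d -> 'rV[Rdefinitions.R]_d)
         (c : nat -> nat -> Rdefinitions.R),
    [/\ X !=set0 /\ convex_set X /\ compact X, closure (interior X) = X,
        is_RIFS X p I psi c, finite_RIFS p I &
        bernoulli_ae p (fun w =>
          (hausdorff_dim (limit_set X I psi w) < bowen_parameter p I c)%E)].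
Proof.
pose R := Rdefinitions.R.
exists 1%N, (slab R 0 1), (weight R), branches, (contraction R),
  (fun i _ => ratio R i); split.
- split; last by split; [exact: slab_convex|exact: slab_compact].
  by exists 0; rewrite /slab/= mxE; lra.
- exact: closure_interior_slab.
- exact: contraction_RIFS.
- by move=> i _; exact: finite_II.
have null : bernoulli_null (weight R)
    (\bigcup_C [set w | forall k, (w k <= C + k)%N]).
  by apply: bernoulli_null_bigcup; [exact: weight_ge0|exact: slow_null].
(* A sequence that is slow for no C satisfies 2/5 < 1/2 between dimension and Bowen parameter, so
   covers of the slow sequences also cover the exceptional set. *)
move=> eps eps0; have [S [cover sumS]] := null eps eps0.
exists S; split=> //; apply: subset_trans cover => w/= bad.
apply: contrapT => notslow; apply: bad.
have fast C : exists n, (C + n < w n)%N.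
  apply: contrapT => slow; apply: notslow; exists C => //= k.
  by rewrite leqNgt; apply/negP => kC; apply: slow; exists k.
apply: le_lt_trans (dim_limit_set_le R w fast) _.
apply: lt_le_trans (bowen_ge R); rewrite lte_fin; lra.
Qed.
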